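(* Let $X$ be a space and $Y\subseteq X$ a non-empty subset. If $Y$ is contractible in $X$, then $\operatorname{TC}(X,Y)=\operatorname{cat}(X)$.
   Context: For a continuous map (fibration) $f:E\to B$, the Schwarz genus $\operatorname{genus}(f)$ is the smallest $k$ such that $B$ has an open cover $U_1,\dots,U_k$ for which each $U_i$ admits a continuous section $s_i:U_i\to E$ of $f$ (and $\infty$ if there is no such $k$). For $Y\subseteq X$, let $P_{X\times Y}$ be the space of continuous paths $\gamma:[0,1]\to X$ with $\gamma(1)\in Y$, and let $\pi:P_{X\times Y}\to X\times Y$, $\pi(\gamma)=(\gamma(0),\gamma(1))$. The relative topological complexity of the pair is $\operatorname{TC}(X,Y)=\operatorname{genus}(\pi)$ (unreduced convention). For a pointed space $(X,x_0)$, let $P_0X$ be the space of paths $\sigma$ in $X$ with $\sigma(1)=x_0$ and $p_0:P_0X\to X\times\{x_0\}$, $p_0(\sigma)=(\sigma(0),x_0)$. The Lusternik-Schnirelmann category is $\operatorname{cat}(X)=\operatorname{genus}(p_0)$; for path-connected $X$ it does not depend on $x_0$. A subspace $Y\subseteq X$ is contractible in $X$ if the inclusion map $\iota:Y\to X$ is homotopic to a constant map. *)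

(* Defs.v *)
From HB Require Import structures.
From mathcomp Require Import all_boot all_order all_algebra.
From mathcomp Require Import all_classical all_reals all_analysis.

Set Implicit Arguments.
Unset Strict Implicit.
Unset Printing Implicit Defensive.

Import Order.TTheory GRing.Theory Num.Theory.
Import numFieldNormedType.Exports.

Local Open Scope classical_set_scope.
Local Open Scope ring_scope.

(* Throughout, a set used as a type is a [set_type], with the topology induced
   by the inclusion (see subtype_topology.v). *)

Section genus.
Context {E B : topologicalType} (f : E -> B).

Definition local_section (U : set B) (s : U -> E) : Prop :=
  continuous s /\ forall b : U, f (s b) = \val b.

Definition genus_le (k : nat) : Prop :=
  exists U : 'I_k -> set B,
    [/\ forall i, open (U i),
        \bigcup_i U i = [set: B] &
        forall i, exists s : U i -> E, local_section s].

Lemma genus_le_asbool :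
  (exists k, genus_le k) -> exists k, `[< genus_le k >].
Proof. by move=> [k kP]; exists k; apply/asboolP. Qed.

(* [None] stands for infinity. *)
Definition genus : option nat :=
  match pselect (exists k, genus_le k) with
  | left ex => Some (ex_minn (genus_le_asbool ex))
  | right _ => None
  end.

End genus.

Section unit_interval.
Context (R : realType).

Definition unit_interval : set R := `[0, 1].

Lemma unit_interval0 : (0 : R) \in unit_interval.
Proof. by rewrite inE /unit_interval /= in_itv /= lexx ler01. Qed.

Lemma unit_interval1 : (1 : R) \in unit_interval.
Proof. by rewrite inE /unit_interval /= in_itv /= lexx ler01. Qed.

Definition I0 : unit_interval := exist _ 0 unit_interval0.
Definition I1 : unit_interval := exist _ 1 unit_interval1.

End unit_interval.

Arguments unit_interval R : clear implicits.
Arguments I0 R : clear implicits.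
Arguments I1 R : clear implicits.

Section relative_TC.
Context (R : realType).
Context (X : topologicalType).
Local Notation I := (set_type (unit_interval R)).

Definition paths_into (Y : set X) : set {compact-open, I -> X} :=
  [set gamma : I -> X | continuous gamma /\ Y (gamma (I1 R))].

Lemma paths_into_end (Y : set X) (gamma : paths_into Y) :
  \val gamma (I1 R) \in Y.
Proof. by case: gamma => g /= /set_mem [_ Yg]; apply/mem_set. Qed.

Definition endpoints (Y : set X) (gamma : paths_into Y) : (X * Y)%type :=
  (\val gamma (I0 R), exist _ (\val gamma (I1 R)) (paths_into_end gamma)).

Definition TC (Y : set X) : option nat := genus (@endpoints Y).

Definition based_paths (x0 : X) : set {compact-open, I -> X} :=
  [set sigma : I -> X | continuous sigma /\ sigma (I1 R) = x0].

Definition base_evaluation (x0 : X) (sigma : based_paths x0) :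
    (X * [set x0])%type :=
  (\val sigma (I0 R), exist _ x0 (mem_set (erefl x0))).

Definition LS_cat (x0 : X) : option nat := genus (@base_evaluation x0).

Definition homotopic (A : topologicalType) (f g : A -> X) : Prop :=
  exists H : A * I -> X,
    [/\ continuous H,
        forall a, H (a, I0 R) = f a &
        forall a, H (a, I1 R) = g a].

Definition contractible_in (Y : set X) : Prop :=
  exists c : X, homotopic (fun y : Y => \val y) (fun=> c).

End relative_TC.

(* Main.v *)
Require Import Defs.
From mathcomp Require Import all_boot all_order all_algebra.
From mathcomp Require Import all_classical all_reals all_analysis.
From mathcomp Require Import lra.

Set Implicit Arguments.
Unset Strict Implicit.
Unset Printing Implicit Defensive.

Import Order.TTheory GRing.Theory Num.Theory.
Import numFieldNormedType.Exports.

Local Open Scope classical_set_scope.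

(** A continuous local section of the path fibration over [U], a set of pairs
    [(x, y)] with [y] in [Y], is a continuous choice of a path from [x] to [y].
    Since the unit interval is compact Hausdorff, currying identifies it with a
    homotopy, over [U], from the first projection to the second
    ([local_section_homotopic]).  The category of [X] based at [x0] is the
    special case where [Y] is the point [x0] ([LS_cat_TC]), and a point is
    contractible in [X].  So it suffices to see that the genus for a nonempty
    [Y] bounds the genus for any [Z] that contracts in [X] to a point [c]
    ([genus_le_endpoints]), and to use this in both directions.

    Fix [y0] in [Y] and pull a cover of [X * Y] back along
    [(x, z) |-> (x, y0)].  Over each pulled back set, the given section connects
    [x] to [y0].  Next, [y0] is joined to [c] by a fixed path, which exists
    because [(c, y0)] lies in some set of the cover.  Finally, the contraction
    of [Z] run backwards connects [c] to [z].  The composite of these three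
    homotopies is a section for [Z]. *)

Section topology.
Local Open Scope ring_scope.

Lemma continuous_set_type (T X : topologicalType) (A : set X) (f : T -> A) :
  continuous (fun t => \val (f t)) -> continuous f.
Proof. by move=> cf; apply: (@continuous_comp_initial _ _ _ set_val). Qed.

Lemma continuous_val (X : topologicalType) (A : set X) :
  continuous (\val : A -> X).
Proof. exact: (@initial_continuous _ _ set_val). Qed.

Lemma continuous_pair (T X Y : topologicalType) (f : T -> X) (g : T -> Y) :
  continuous f -> continuous g -> continuous (fun t => (f t, g t)).
Proof. by move=> cf cg t; apply: cvg_pair; [exact: cf|exact: cg]. Qed.

Lemma continuous_injective_hausdorff (T X : topologicalType) (f : T -> X) :
  continuous f -> injective f -> hausdorff_space X -> hausdorff_space T.
Proof.
move=> cf injf hX p q clpq; apply/injf/hX => A B fpA fqB.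
have [x [Ax Bx]] := clpq _ _ (cf p _ fpA) (cf q _ fqB).
by exists (f x).
Qed.

(** The pasting lemma for the closed sets [h <= c] and [h >= c].  Having [F] and
    [G] continuous on all of [T] reduces the points where [h = c] to
    intersecting two neighborhoods. *)
Lemma continuous_paste (R : realType) (T X : topologicalType) (h : T -> R)
    (c : R) (F G : T -> X) :
  continuous h -> continuous F -> continuous G ->
  (forall t, h t = c -> F t = G t) ->
  continuous (fun t => if h t <= c then F t else G t).
Proof.
move=> ch cF cG FG t W /=.
(* unfolds the image filter, so that near ranges over [T] rather than [X] *)
change (nbhs (if h t <= c then F t else G t) W ->
  \forall s \near t, W (if h s <= c then F s else G s)).
case: (ltgtP (h t) c) => [ltc|gtc|/[dup] htc /FG e].
- move=> FW; have hlt : \forall s \near t, h s < c.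
    by apply: (ch t [set y | y < c]); exact: lt_nbhsl.
  near=> s; rewrite ifT; last by apply: ltW; near: s.
  by near: s; exact: cF.
- move=> GW; have hgt : \forall s \near t, c < h s.
    by apply: (ch t [set y | c < y]); exact: lt_nbhsr.
  near=> s; rewrite ifF; last by apply/negbTE; rewrite -ltNge; near: s.
  by near: s; exact: cG.
- move=> FW; have GW : nbhs (G t) W by rewrite -e.
  near=> s; case: ifPn => _; near: s; [exact: cF|exact: cG].
Unshelve. all: by end_near. Qed.

End topology.

Section interval.
Local Open Scope ring_scope.
Context (R : realType).
Local Notation I := (set_type (unit_interval R)).

Lemma clamp_in (x : R) : Num.max 0 (Num.min 1 x) \in unit_interval R.
Proof.
rewrite inE /unit_interval /= in_itv /=.
by rewrite le_max lexx /= ge_max ler01 ge_min lexx.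
Qed.

(** The retraction of the line onto the unit interval: it turns real formulas
    for reparametrizations into maps of the interval without side conditions. *)
Definition clamp (x : R) : I :=
  exist (fun y => y \in unit_interval R) _ (clamp_in x).

Lemma clampE (x : R) (t : I) : x = \val t -> clamp x = t.
Proof.
move=> ->; apply: val_inj => /=; case: t => t /= /set_mem.
rewrite /unit_interval /= in_itv /= => /andP[t0 t1].
by rewrite (min_idPr t1) (max_idPr t0).
Qed.

Lemma continuous_clamp : continuous clamp.
Proof.
apply: continuous_set_type => /= x.
apply: (@continuous_max R R^o (cst 0)); first exact: cst_continuous.
apply: (@continuous_min R R^o (cst 1)); first exact: cst_continuous.
exact: cvg_id.
Qed.

Lemma hausdorff_unit_interval : hausdorff_space I.
Proof.
apply: (@continuous_injective_hausdorff _ R (\val : I -> R)).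
- exact: continuous_val.
- exact: val_inj.
- exact: Rhausdorff.
Qed.

Lemma compact_unit_interval : compact [set: I].
Proof.
have -> : [set: I] = clamp @` `[0, 1].
  rewrite eqEsubset; split=> // t _; exists (\val t); last exact: clampE.
  by case: t => t /= /set_mem.
apply: continuous_compact; last exact: segment_compact.
by apply: continuous_subspaceT; exact: continuous_clamp.
Qed.

Lemma locally_compact_unit_interval : locally_compact [set: I].
Proof.
move=> t _; exists setT; first exact: filterT.
by split; [exact: compact_unit_interval|exact: closedT].
Qed.

End interval.

Section homotopy.
Local Open Scope ring_scope.
Context (R : realType) (X : topologicalType).
Local Notation I := (set_type (unit_interval R)).

Lemma continuous_reparametrize (A : topologicalType) (H : A * I -> X)
    (phi : R -> R) : continuous H -> continuous phi ->
  continuous (fun p : A * I => H (p.1, clamp (phi (\val p.2)))).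
Proof.
move=> cH cphi; have : continuous
    (fun p : A * I => (p.1, clamp (phi (\val p.2)))).
  apply: continuous_pair => p; first exact: cvg_fst.
  apply: (continuous_comp (g := @clamp R)); last exact: continuous_clamp.
  apply: (continuous_comp (g := phi)); last exact: cphi.
  apply: (continuous_comp (f := snd)); first exact: cvg_snd.
  exact: continuous_val.
by move=> c p; apply: continuous_comp; [exact: c|exact: cH].
Qed.

Lemma homotopic_refl (A : topologicalType) (f : A -> X) :
  continuous f -> homotopic R f f.
Proof.
move=> cf; exists (f \o fst); split=> // p.
by apply: continuous_comp; [exact: cvg_fst|exact: cf].
Qed.

Lemma homotopic_precomp (A B : topologicalType) (h : B -> A) (f g : A -> X) :
  continuous h -> homotopic R f g -> homotopic R (f \o h) (g \o h).
Proof.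
move=> ch [H [cH H0 H1]]; exists (fun p => H (h p.1, p.2)).
split=> [||]; [|by move=> b; exact: H0|by move=> b; exact: H1].
have : continuous (fun p : B * I => (h p.1, p.2)).
  apply: continuous_pair => p; last exact: cvg_snd.
  by apply: continuous_comp; [exact: cvg_fst|exact: ch].
by move=> c p; apply: continuous_comp; [exact: c|exact: cH].
Qed.

Lemma homotopic_sym (A : topologicalType) (f g : A -> X) :
  homotopic R f g -> homotopic R g f.
Proof.
move=> [H [cH H0 H1]]; exists (fun p => H (p.1, clamp (1 - \val p.2))).
split=> [|a|a] /=.
- apply: (continuous_reparametrize (phi := fun x => 1 - x)) => // x.
  by apply: continuousB; [exact: cvg_cst|exact: cvg_id].
- by rewrite (clampE (t := I1 R)) // /= subr0.
- by rewrite (clampE (t := I0 R)) // /= subrr.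
Qed.

Lemma homotopic_trans (A : topologicalType) (f g h : A -> X) :
  homotopic R f g -> homotopic R g h -> homotopic R f h.
Proof.
move=> [H [cH H0 H1]] [K [cK K0 K1]].
pose F (p : A * I) := H (p.1, clamp (2 * \val p.2)).
pose G (p : A * I) := K (p.1, clamp (2 * \val p.2 - 1)).
exists (fun p => if \val p.2 <= 2^-1 then F p else G p).
have c2 : continuous (fun x : R => 2 * x).
  exact: mulrl_continuous.
split=> [|a|a] /=.
- apply: (@continuous_paste R _ _ (fun p : A * I => \val p.2)).
  + move=> p; apply: (continuous_comp (f := snd)); first exact: cvg_snd.
    exact: continuous_val.
  + exact: (continuous_reparametrize (phi := fun x => 2 * x)).
  + apply: (continuous_reparametrize (phi := fun x => 2 * x - 1)) => // x.
    by apply: continuousB; [exact: c2|exact: cvg_cst].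
  + move=> p e; rewrite /F /G e (clampE (t := I1 R)) /= ?H1; last by lra.
    by rewrite (clampE (t := I0 R)) /= ?K0 //; lra.
- by rewrite ifT ?invr_ge0 // /F (clampE (t := I0 R)) ?H0 //= mulr0.
- rewrite ifF; last by apply/negbTE; rewrite -ltNge; lra.
  by rewrite /G (clampE (t := I1 R)) ?K1 //=; lra.
Qed.

End homotopy.

Section motion_planning.
Context (R : realType) (X : topologicalType).
Local Notation I := (set_type (unit_interval R)).

(** The exponential law for the unit interval.  It replaces the path space by
    homotopies on [U], so that sections can be composed, reversed and
    restricted as homotopies are. *)
Lemma local_section_homotopic (Y : set X) (U : set (X * Y)%type) :
  (exists s : U -> paths_into Y, local_section (@endpoints R X Y) s) <->
  homotopic R (fun u : U => (\val u).1) (fun u : U => \val (\val u).2).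
Proof.
split=> [[s [cs sE]]|[H [cH H0 H1]]].
  pose g (u : U) : {compact-open, I -> X} := \val (s u).
  exists (uncurry g); split=> [|u|u]; last 2 first.
  - by rewrite -sE.
  - by rewrite -sE.
  apply: continuous_uncurry.
  - exact: locally_compact_unit_interval.
  - exact: hausdorff_unit_interval.
  - have cv := @continuous_val {compact-open, I -> X} (paths_into Y).
    by move=> u; exact: (continuous_comp (cs u) (cv (s u))).
  - by move=> u; rewrite /g; case: (s u) => p /= /set_mem[].
have [cc cu] := continuous_curry cH.
have Hin u : (curry H u : {compact-open, I -> X}) \in paths_into Y.
  apply/mem_set; split; first exact: cu.
  by rewrite /curry H1; case: (\val u).2 => y /= /set_mem.
exists (fun u => exist (fun p => p \in paths_into Y) _ (Hin u)); split.
  exact: continuous_set_type.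
move=> u; rewrite [RHS]surjective_pairing; congr pair; first exact: H0.
by apply: val_inj; exact: H1.
Qed.

(** Over a pair [(x, z)] the new section follows the old one from [x] to a fixed
    [y0] in [Y], then a fixed path from [y0] to the point [c] to which [Z]
    contracts, then the contraction backwards from [c] to [z]. *)
Lemma genus_le_endpoints (Y Z : set X) (k : nat) :
  Y !=set0 -> contractible_in R Z ->
  genus_le (@endpoints R X Y) k -> genus_le (@endpoints R X Z) k.
Proof.
move=> [y0 Yy0] [c Zc] [U [oU covU secU]].
pose y : Y := exist (fun z => z \in Y) y0 (mem_set Yy0).
pose h (xz : X * Z) : X * Y := (xz.1, y).
have ch : continuous h.
  by apply: continuous_pair => p; [exact: cvg_fst|exact: cvg_cst].
have {}secU i : homotopic R (fun u : U i => (\val u).1)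
                            (fun u : U i => \val (\val u).2).
  exact/local_section_homotopic.
(* the section through [(c, y)] is a path from [c] to [y0] *)
have y0c (A : topologicalType) : homotopic R (fun=> y0 : X) (fun _ : A => c).
  have : [set: X * Y] (c, y) by [].
  rewrite -covU => -[i _ Ui].
  pose q (_ : A) : U i := exist (fun p => p \in U i) (c, y) (mem_set Ui).
  apply: homotopic_sym; apply: (homotopic_precomp (h := q) _ (secU i)).
  exact: cst_continuous.
exists (fun i => h @^-1` U i); split.
- by move=> i; apply: open_comp => // p _; exact: ch.
- rewrite eqEsubset; split=> // p _.
  have : [set: X * Y] (h p) by [].
  by rewrite -covU => -[i _ Ui]; exists i.
move=> i; apply/local_section_homotopic.
pose V := h @^-1` U i.
have hV (v : V) : h (\val v) \in U i by case: v => v /= /set_mem /mem_set.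
pose q (v : V) : U i := exist (fun p => p \in U i) _ (hV v).
have cq : continuous q.
  apply: continuous_set_type => v /=.
  by apply: (continuous_comp (g := h)); [exact: continuous_val|exact: ch].
apply: homotopic_trans (homotopic_precomp cq (secU i)) _.
apply: homotopic_trans (y0c V) _.
apply: homotopic_sym.
apply: (homotopic_precomp (h := fun v : V => (\val v).2)) Zc => v.
by apply: (continuous_comp (g := snd)); [exact: continuous_val|exact: cvg_snd].
Qed.

(** Membership in the singleton unfolds to an equality, so both path spaces are
    the same; the two maps only differ in how the endpoint is presented. *)
Lemma LS_cat_TC (x0 : X) : LS_cat R x0 = TC R [set x0].
Proof.
rewrite /LS_cat /TC; congr genus; apply/funext => s; congr pair.
by apply: val_inj; case: s => p /= /set_mem[].
Qed.

End motion_planning.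

Lemma eq_genus (E E' B B' : topologicalType) (f : E -> B) (g : E' -> B') :
  (forall k, genus_le f k <-> genus_le g k) -> genus f = genus g.
Proof.
move=> fg; rewrite /genus.
case: pselect => [exf|nf]; case: pselect => [exg|ng] //.
- congr Some; case: ex_minnP => m /asboolP/fg fm mmin.
  case: ex_minnP => n /asboolP/fg gn nmin.
  by apply/eqP; rewrite eqn_leq mmin ?nmin //; exact/asboolP.
- by exfalso; case: exf => k /fg ?; apply: ng; exists k.
- by exfalso; case: exg => k /fg ?; apply: nf; exists k.
Qed.

Theorem theorem3p10 (R : realType) (X : topologicalType) (Y : set X) :
  Y !=set0 -> contractible_in R Y ->
  forall x0 : X, TC R Y = LS_cat R x0.
Proof.
move=> Y0 Yc x0; rewrite LS_cat_TC; apply: eq_genus => k.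
have x0c : contractible_in R [set x0].
  exists x0; have -> : (fun x : [set x0] => \val x) = fun=> x0.
    by apply/funext => -[x /= /set_mem].
  by apply: homotopic_refl; exact: cst_continuous.
by split; apply: genus_le_endpoints => //; exists x0.
Qed.
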